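(* Let $1<\eta\le\alpha<\infty$ and $\beta>\alpha^{d}$. Then $rbmo^{1}_{\mathscr Q}(\mu)=rbmo(\mu)$ with equivalent norms; that is, a function $f\in L_{loc}(\mu)$ belongs to $rbmo^{1}_{\mathscr Q}(\mu)$ if and only if it belongs to $rbmo(\mu)$, and there is a constant $C\ge 1$, independent of $f$, such that $C^{-1}\|f\|_{*1}\le \|f\|_{rbmo(\mu)}\le C\|f\|_{*1}$ for all such $f$.
   Context: Let $d\ge 1$ be an integer, $0<n\le d$, and let $\mu$ be a positive Radon measure on $\mathbb R^{d}$ satisfying the growth condition $\mu(Q(x,l))\le C_{0}l^{n}$ for all $x\in\mathbb R^{d}$, $l>0$, with a fixed constant $C_0>0$, where $Q(x,l)$ is the cube centered at $x$ with side length $l$. The measure $\mu$ is not assumed to be doubling. A cube is a closed cube in $\mathbb R^d$ with sides parallel to the coordinate axes; $l(Q)$ is the side length of $Q$ and, for $\lambda>0$, $\lambda Q$ is the cube concentric with $Q$ of side length $\lambda l(Q)$. $L_{loc}(\mu)$ is the space of real-valued locally $\mu$-integrable functions, and $m_Qf=\frac1{\mu(Q)}\int_Q f\,d\mu$. Doubling cubes: with $\alpha>1$ and $\beta>\alpha^d$ fixed, a cube $Q$ is $(\alpha,\beta)$-doubling if $\mu(\alpha Q)\le\beta\mu(Q)$. For a cube $Q$, $\widetilde Q$ is the smallest $(\alpha,\beta)$-doubling cube of the form $\alpha^mQ$ with $m\in\{0,1,2,\dots\}$, and $Q'$ is the biggest $(\alpha,\beta)$-doubling cube of the form $\alpha^{-N}Q$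 with $N\in\{1,2,\dots\}$. (The assumption $\beta>\alpha^d$ is made to guarantee existence of these cubes; for a given side length, $Q'$ exists for $\mu$-almost every center.) Put $\mathscr Q=\{Q: l(Q)\le 1\}$ and $\mathscr Q_{ex}=\{Q: l(Q')\le 1\}$, where $Q\in\mathscr Q_{ex}$ means that $Q'$ exists and $l(Q')\le1$. For cubes $Q\subset R$, $K_{Q,R}=1+\sum_{k=1}^{N_{Q,R}}\frac{\mu(2^kQ)}{l(2^kQ)^n}$, where $N_{Q,R}$ is the first integer $k\ge 0$ with $l(2^kQ)\ge l(R)$. Conditions below involving means or quotients with a measure in the denominator are imposed only for cubes for which these are defined (positive denominators). $rbmo^1_{\mathscr Q}(\mu)$: the set of $f\in L_{loc}(\mu)$ for which there is a constant $C_3\ge0$ such that (a) for every cube $Q\in\mathscr Q$, $\frac1{\mu(\eta Q)}\int_Q|f-m_{\widetilde Q}f|\,d\mu\le C_3$; (b) for any two $(\alpha,\beta)$-doubling cubes $Q\subset R$ with $Q\in\mathscr Q$ and $R\in\mathscr Q_{ex}$, $|m_Qf-m_Rf|\le C_3K_{Q,R}$; (c) for every cube $Q\in\mathscr Q_{ex}\setminus\mathscr Q$, $\frac1{\mu(\eta Q)}\int_Q|f|\,d\mu\le C_3$. The norm $\|f\|_{*1}$ is the infimum of such $C_3$. $rbmo(\mu)$: the set of $f\in L_{loc}(\mu)$ for which there is a constant $C_2\ge0$ such that (a) for every cube $Q$ with $l(Q)\le1$, $\frac1{\mu(\eta Q)}\int_Q|f-m_{\widetilde Q}f|\,d\mu\le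 C_2$; (b) for any two $(\alpha,\beta)$-doubling cubes $Q\subset R$ with $l(Q)\le1$, $|m_Qf-m_Rf|\le C_2K_{Q,R}$; (c) for every cube $Q$ with $l(Q)>1$, $\frac1{\mu(\eta Q)}\int_Q|f|\,d\mu\le C_2$. The norm $\|f\|_{rbmo(\mu)}$ is the infimum of such $C_2$. *)

(* Defs.v *)
From HB Require Import structures.
From mathcomp Require Import all_boot all_order all_algebra.
From mathcomp Require Import all_classical all_reals all_analysis.

Set Implicit Arguments.
Unset Strict Implicit.
Unset Printing Implicit Defensive.

Import Order.TTheory GRing.Theory Num.Theory.
Import numFieldNormedType.Exports.

Local Open Scope classical_set_scope.
Local Open Scope ring_scope.

(* R^d with the sigma-algebra generated by its open sets. *)
Notation borelRd R d := (g_sigma_algebraType (@open 'rV[R]_d)).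

Section cubes.
Context {R : realType} {d : nat}.

(* Center and side length of an axis-parallel cube. The record also contains
   degenerate data; genuine cubes are those in [cubes]. *)
Record cube := Cube { center : 'rV[R]_d ; side : R }.

Definition cubes : set cube := [set Q | 0 < side Q].

Definition cube_set (Q : cube) : set (borelRd R d) :=
  [set y : 'rV[R]_d |
    forall i : 'I_d, `|y ord0 i - center Q ord0 i| <= side Q / 2].

Definition dilate (lam : R) (Q : cube) : cube :=
  Cube (center Q) (lam * side Q).

End cubes.
Arguments cube R d : clear implicits.
Arguments cubes R d : clear implicits.

(* The least element of P, and 0 if P is empty. *)
Definition first_nat (P : set nat) : nat :=
  xget 0%N [set k | P k /\ forall j, P j -> (k <= j)%N].

Section rbmo_spaces.
Context {R : realType} {d : nat}.
Variable mu : {measure set (borelRd R d) -> \bar R}.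
(* n is the growth exponent, a real number. *)
Variables n alpha beta eta : R.

Definition radon : Prop :=
  [/\ forall K : set 'rV[R]_d, compact K -> (mu K < +oo)%E,
      forall A : set (borelRd R d), measurable A ->
        mu A = ereal_inf [set mu U | U in
                 [set U : set 'rV[R]_d | open U /\ A `<=` U]]
    & forall U : set 'rV[R]_d, open U ->
        mu U = ereal_sup [set mu K | K in
                 [set K : set 'rV[R]_d | compact K /\ K `<=` U]]].

Definition growth (C0 : R) : Prop :=
  forall (x : 'rV[R]_d) (l : R), 0 < l ->
    (mu (cube_set (Cube x l)) <= (C0 * l `^ n)%:E)%E.

Definition loc_integrable (f : borelRd R d -> R) : Prop :=
  measurable_fun setT f /\
  forall K : set 'rV[R]_d, compact K -> mu.-integrable K (EFin \o f).

(* The mass mu(Q) as a real number; it is finite under [growth]. *)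
Definition mass (Q : cube R d) : R := fine (mu (cube_set Q)).

Definition mean (Q : cube R d) (f : borelRd R d -> R) : R :=
  (mass Q)^-1 * \int[mu]_(x in cube_set Q) f x.

Definition doubling (Q : cube R d) : Prop :=
  (mu (cube_set (dilate alpha Q)) <= beta%:E * mu (cube_set Q))%E.

(* The smallest doubling cube alpha^m Q with m >= 0. *)
Definition tildeQ (Q : cube R d) : cube R d :=
  dilate (alpha ^+ first_nat [set m | doubling (dilate (alpha ^+ m) Q)]) Q.

Definition inner_doubling (Q : cube R d) : set nat :=
  [set N | (0 < N)%N /\ doubling (dilate (alpha ^- N) Q)].

(* The biggest doubling cube alpha^{-N} Q with N >= 1; meaningful only if
   [inner_doubling Q] is nonempty. *)
Definition primeQ (Q : cube R d) : cube R d :=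
  dilate (alpha ^- first_nat (inner_doubling Q)) Q.

Definition scriptQ : set (cube R d) :=
  [set Q | cubes R d Q /\ side Q <= 1].

Definition scriptQ_ex : set (cube R d) :=
  [set Q | [/\ cubes R d Q, inner_doubling Q !=set0 & side (primeQ Q) <= 1]].

Definition N_QR (Q S : cube R d) : nat :=
  first_nat [set k | side S <= side (dilate (2 ^+ k) Q)].

Definition K_QR (Q S : cube R d) : R :=
  1 + \sum_(1 <= k < (N_QR Q S).+1)
        mass (dilate (2 ^+ k) Q) / side (dilate (2 ^+ k) Q) `^ n.

Definition osc_quot (Q : cube R d) (f : borelRd R d -> R) : R :=
  (mass (dilate eta Q))^-1 *
  \int[mu]_(x in cube_set Q) `|f x - mean (tildeQ Q) f|.

Definition abs_quot (Q : cube R d) (f : borelRd R d -> R) : R :=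
  (mass (dilate eta Q))^-1 * \int[mu]_(x in cube_set Q) `|f x|.

(* In both families of conditions, the hypotheses on [mass] restrict each
   inequality to the cubes for which its denominators are positive. *)

Definition rbmo1_bound (f : borelRd R d -> R) (C : R) : Prop :=
  [/\ 0 <= C,
      forall Q, scriptQ Q ->
        0 < mass (dilate eta Q) -> 0 < mass (tildeQ Q) ->
        osc_quot Q f <= C,
      forall Q S, scriptQ Q -> scriptQ_ex S -> doubling Q -> doubling S ->
        cube_set Q `<=` cube_set S -> 0 < mass Q -> 0 < mass S ->
        `|mean Q f - mean S f| <= C * K_QR Q S
    & forall Q, (scriptQ_ex `\` scriptQ) Q ->
        0 < mass (dilate eta Q) ->
        abs_quot Q f <= C].

Definition rbmo1 : set (borelRd R d -> R) :=
  [set f | loc_integrable f /\ exists C, rbmo1_bound f C].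

Definition rbmo1_norm (f : borelRd R d -> R) : R :=
  inf [set C | rbmo1_bound f C].

Definition rbmo_bound (f : borelRd R d -> R) (C : R) : Prop :=
  [/\ 0 <= C,
      forall Q, cubes R d Q -> side Q <= 1 ->
        0 < mass (dilate eta Q) -> 0 < mass (tildeQ Q) ->
        osc_quot Q f <= C,
      forall Q S, cubes R d Q -> cubes R d S -> side Q <= 1 ->
        doubling Q -> doubling S ->
        cube_set Q `<=` cube_set S -> 0 < mass Q -> 0 < mass S ->
        `|mean Q f - mean S f| <= C * K_QR Q S
    & forall Q, cubes R d Q -> 1 < side Q ->
        0 < mass (dilate eta Q) ->
        abs_quot Q f <= C].

Definition rbmo : set (borelRd R d -> R) :=
  [set f | loc_integrable f /\ exists C, rbmo_bound f C].

Definition rbmo_norm (f : borelRd R d -> R) : R :=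
  inf [set C | rbmo_bound f C].

End rbmo_spaces.

(* Main.v *)
Require Import Defs.
From HB Require Import structures.
From mathcomp Require Import all_boot all_order all_algebra.
From mathcomp Require Import all_classical all_reals all_analysis.
From mathcomp Require Import measurable_realfun lra ring.

(** The two definitions differ in one point: the conditions of rbmo^1 on large
    cubes are imposed only on cubes R for which R' exists and has side at most
    1.  Hence every constant admissible for rbmo is admissible for rbmo^1, and
    the theorem amounts to the converse up to a factor D that does not depend
    on f ([rbmo_bound_of_rbmo1_bound]).

    Averages over large cubes.  If 1 < l(Q) < alpha and Q' exists, then
    l(Q') <= l(Q) / alpha <= 1, so rbmo^1 controls the integral of |f| over Q.
    Q' may fail to exist, because the masses of alpha^-N Q may decrease faster
    than beta^-N.  The centres where this happens are negligible: if they
    filled a cube, covering it by about alpha^(Nd) cubes of side alpha^-N l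
    would bound its mass by a multiple of (alpha^d / beta)^N for all N.
    So good centres exist arbitrarily near that of Q
    ([exists_inner_doubling_near]), and the estimate passes to Q because the
    mass of closed cubes is continuous under shrinking
    ([abs_int_le_medium]).  A cube with l(Q) >= alpha is covered by a grid of
    cubes of side (1 + alpha) / 2 contained in Q; their eta-dilates lie in
    eta Q and overlap boundedly ([abs_int_le_large]).

    Differences of means.  Let Q be included in R, both doubling, l(Q) <= 1.
    If l(R) <= 1, let T be the smallest doubling cube alpha^m R with m >= 1.
    Then T' is R, so rbmo^1 compares both Q and R with T.
    If l(R) > 1, the mean over R is controlled by the first part, since
    eta <= alpha and R is doubling; and Q is compared with the first doubling
    cube T of side greater than 1 among the alpha^m Q, whose mean is bounded
    for the same reason.  In both cases one
    needs K_{Q,T} <= K_{Q,R} + C1: between the two scales the cubes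
    alpha^i R are not doubling, so their masses decay like beta^-i going down
    from T while growth bounds the mass of T by C0 l(T)^n, and as
    alpha^n <= alpha^d < beta the additional terms of K form a geometric
    series ([K_QR_skip_nondoubling]). *)

Set Implicit Arguments.
Unset Strict Implicit.
Unset Printing Implicit Defensive.

Import Order.TTheory GRing.Theory Num.Theory.
Import numFieldNormedType.Exports.

Local Open Scope classical_set_scope.
Local Open Scope ring_scope.

(** * Axis-parallel cubes *)

Section cube_geometry.
Context {R : realType} {d : nat}.
Implicit Types P Q : cube R d.

Lemma dilate_dilate a b Q : dilate a (dilate b Q) = dilate (a * b) Q.
Proof. by rewrite /dilate /= mulrA. Qed.

Lemma dilate1 Q : dilate 1 Q = Q.
Proof. by case: Q => c s; rewrite /dilate /= mul1r. Qed.

Lemma cube_set_sub P Q :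
  (forall i, `|Defs.center P ord0 i - Defs.center Q ord0 i| + side P / 2 <= side Q / 2) ->
  cube_set P `<=` cube_set Q.
Proof.
move=> PQ y /= yP i; apply: le_trans (PQ i).
rewrite [leRHS]addrC; apply: le_trans (lerD (yP i) (lexx _)).
by apply: le_trans (ler_normD _ _); rewrite addrA subrK.
Qed.

Lemma dilate_sub a b Q : 0 <= side Q -> a <= b ->
  cube_set (dilate a Q) `<=` cube_set (dilate b Q).
Proof.
move=> Q0 ab; apply: cube_set_sub => i /=.
by rewrite subrr normr0 add0r ler_pM2r ?invr_gt0// ler_wpM2r.
Qed.

Lemma closed_cube_set Q : closed (cube_set Q : set 'rV[R]_d).
Proof.
have -> : (cube_set Q : set 'rV[R]_d) = \bigcap_(i in [set: 'I_d])
    ((fun y : 'rV[R]_d => y ord0 i) @^-1`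
      [set t | `|t - Defs.center Q ord0 i| <= side Q / 2]).
  by apply/seteqP; split => y /= yQ i; [move=> _|]; exact: yQ.
apply: closed_bigI => i _; apply: closed_comp.
  by move=> y _; exact: coord_continuous.
rewrite (_ : [set t | _] = [set t | Defs.center Q ord0 i - side Q / 2 <= t] `&`
    [set t | t <= Defs.center Q ord0 i + side Q / 2]).
  by apply: closedI; [exact: closed_ge|exact: closed_le].
by apply/seteqP; split => t /=; rewrite ler_distl => /andP.
Qed.

Lemma measurable_cube_set Q : measurable (cube_set Q).
Proof.
rewrite -(setCK (cube_set Q)); apply: measurableC.
by apply: sub_sigma_algebra; exact/closed_openC/closed_cube_set.
Qed.

Lemma compact_cube_set Q : compact (cube_set Q : set 'rV[R]_d).
Proof.
apply: (@rV_compact R d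
  (fun i => [set t | `|t - Defs.center Q ord0 i| <= side Q / 2])) => i.
rewrite (_ : [set t | _] =
  `[Defs.center Q ord0 i - side Q / 2, Defs.center Q ord0 i + side Q / 2]%classic).
  exact: segment_compact.
by apply/seteqP; split => t /=; rewrite in_itv/= ler_distl.
Qed.

End cube_geometry.

#[local] Hint Extern 0 (measurable (cube_set _)) =>
  solve [exact: measurable_cube_set] : core.

(** * Finite covers *)

Section covering.
Context {disp : measure_display} {T : measurableType disp} {R : realType}.
Variable mu : {measure set T -> \bar R}.

Lemma integral_cover (I : eqType) (s : seq I) (A : set T) (F : I -> set T)
    (g : T -> \bar R) :
  measurable A -> (forall i, measurable (F i)) -> measurable_fun setT g ->
  (forall x, 0 <= g x)%E -> A `<=` \bigcup_(i in [set` s]) F i ->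
  (\int[mu]_(x in A) g x <= \sum_(i <- s) \int[mu]_(x in F i) g x)%E.
Proof.
move=> mA mF mg g0; elim: s A mA => [|h s IH] A mA AF.
  have -> : A = set0 by apply/seteqP; split => // x /AF[].
  by rewrite big_nil integral_set0.
have mAF : measurable (A `\` F h) by exact: measurableD.
have mgB B : measurable_fun B g by exact: measurable_funTS.
rewrite big_cons; apply: (@le_trans _ _ (\int[mu]_(x in F h `|` (A `\` F h)) g x)%E).
  apply: ge0_subset_integral => //; first exact: measurableU.
  by move=> x Ax; have [?|?] := pselect (F h x); [left|right].
rewrite ge0_integral_setU//; last by rewrite disj_set2E setDIK.
apply: leeD => //; apply: IH => // x [Ax nFx].
have [i /=] := AF x Ax; rewrite inE => /predU1P[->|si] Fi //.
by exists i.
Qed.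

Lemma measure_cover (I : eqType) (s : seq I) (A : set T) (F : I -> set T) :
  measurable A -> (forall i, measurable (F i)) ->
  A `<=` \bigcup_(i in [set` s]) F i -> (mu A <= \sum_(i <- s) mu (F i))%E.
Proof.
move=> mA mF AF.
have intE B : measurable B -> (\int[mu]_(x in B) cst 1 x)%E = mu B.
  by move=> mB; rewrite integral_cst// mul1e.
rewrite -intE// (eq_bigr _ (fun i _ => esym (intE _ (mF i)))).
by apply: integral_cover.
Qed.

(** Integrate over [A] the sum of the indicators of the [F i], which is at most
    [B] pointwise. *)
Lemma measure_overlap (I : finType) (A : set T) (F : I -> set T) (B : nat) :
  measurable A -> (forall i, measurable (F i)) -> (forall i, F i `<=` A) ->
  (forall x, A x -> (#|[pred i | x \in F i]| <= B)%N) ->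
  (\sum_i mu (F i) <= B%:R%:E * mu A)%E.
Proof.
move=> mA mF FA cB.
have muF i : mu (F i) = (\int[mu]_(x in A) (\1_(F i) x)%:E)%E.
  by rewrite integral_indic// setIidl.
rewrite (eq_bigr _ (fun i _ => muF i)) -ge0_integral_sum//; first last.
- by move=> i; apply/measurable_EFinP; exact: measurable_indic.
rewrite -integral_cst//; apply: ge0_le_integral => //.
- by move=> x _; rewrite sumEFin lee_fin sumr_ge0// => i _; rewrite indicE ler0n.
- apply: emeasurable_sum => i; apply/measurable_EFinP; exact: measurable_indic.
- move=> x Ax; rewrite sumEFin lee_fin.
  rewrite (_ : (\sum_i _) = #|[pred i | x \in F i]|%:R) ?ler_nat ?cB//.
  rewrite -sum1_card natr_sum [RHS]big_mkcond/=.
  by apply: eq_bigr => i _; rewrite indicE inE; case: ifP.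
Qed.

End covering.

(** * Grids *)

Section real_lemmas.
Context {R : realType}.

Lemma segment_cover (M : nat) (delta s u : R) : delta <= s ->
  0 <= u <= M%:R * delta + s ->
  exists j : 'I_M.+1, j%:R * delta <= u <= j%:R * delta + s.
Proof.
move=> ds; elim: M => [|M IH] /andP[u0 us].
  by exists ord0; rewrite mul0r add0r u0; rewrite mul0r add0r in us.
have [uM|Mu] := leP u (M%:R * delta + s).
  have [|j ju] := IH; first by rewrite u0.
  by exists (widen_ord (leqnSn _) j).
by exists ord_max; rewrite us andbT -natr1 mulrDl mul1r /=; lra.
Qed.

(** Two points of a grid of step [delta] lying in a window of length [w] have
    indices differing by at most [w / delta]. *)
Lemma card_grid_window (M B : nat) (delta u w : R) :
  0 < delta -> w < B%:R * delta ->
  (#|[pred j : 'I_M.+1 | (`|u - j%:R * delta| <= w / 2)%R]| <= B)%N.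
Proof.
move=> delta0 wB; set S := [pred j : 'I_M.+1 | _].
have [j1 Sj1|S0] := pickP S; last by rewrite eq_card0.
case: (@arg_minnP _ j1 S (fun j => j : nat) Sj1) => j0 Sj0 minj0.
(* Shifting the indices by the least one embeds them in {0, ..., B - 1}. *)
rewrite cardE -(size_map (fun j : 'I_M.+1 => (j - j0)%N)) -[leqRHS](size_iota 0).
apply: uniq_leq_size.
  rewrite map_inj_in_uniq ?enum_uniq// => j k; rewrite !mem_enum => Sj Sk jk.
  apply/val_inj => /=.
  by rewrite -(subnK (minj0 _ Sj)) -(subnK (minj0 _ Sk)) jk.
move=> t /mapP[j]; rewrite mem_enum => Sj ->.
rewrite mem_iota add0n /= -(ltr_nat R) natrB ?minj0//.
rewrite -(ltr_pM2r delta0) mulrBl; apply: le_lt_trans wB.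
move: Sj Sj0; rewrite !inE !ler_norml => /andP[? ?] /andP[? ?]; lra.
Qed.

Lemma le0_of_geometric (K r a : R) : 0 <= r < 1 ->
  (forall N, a <= K * r ^+ N) -> a <= 0.
Proof.
move=> /andP[r0 r1] aKr.
have cvg0 : (fun N => K * r ^+ N) @ \oo --> (0 : R).
  by apply: cvg_geometric; rewrite ger0_norm.
rewrite -(cvg_lim _ cvg0)//; apply: limr_ge.
  by apply/cvg_ex; exists 0.
by apply: nearW.
Qed.

Lemma exprn_large (a x : R) : 1 < a -> exists k, x < a ^+ k.
Proof.
move=> a1; apply/not_existsP => ax.
have a0 : 0 < a by lra.
suff : (1 : R) <= 0 by rewrite ler10.
apply: (@le0_of_geometric x a^-1) => [|k].
  by rewrite invr_ge0 ltW//= invf_lt1.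
by rewrite exprVn ler_pdivlMr ?exprn_gt0// mul1r leNgt; apply/negP/ax.
Qed.

End real_lemmas.

Section grid.
Context {R : realType} {d : nat}.
Implicit Types Q : cube R d.

(** The centres form a regular grid of step [delta] whose lowest cube shares
    its lowest corner with [Q]; when [M * delta = side Q - s], the highest cube
    shares the highest corner of [Q]. *)
Definition grid_cube Q (s delta : R) M (i : {ffun 'I_d -> 'I_M.+1}) : cube R d :=
  Cube (\row_k (Defs.center Q ord0 k - (side Q - s) / 2 + (i k)%:R * delta)) s.

Lemma grid_cover Q (s delta : R) M : delta <= s -> M%:R * delta = side Q - s ->
  cube_set Q `<=` \bigcup_(i in [set` index_enum {ffun 'I_d -> 'I_M.+1}])
                     cube_set (grid_cube Q s delta i).
Proof.
move=> ds MQ y yQ.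
have ex k : exists j : 'I_M.+1,
    j%:R * delta <= y ord0 k - Defs.center Q ord0 k + side Q / 2
      <= j%:R * delta + s.
  apply: segment_cover => //; rewrite MQ.
  have := yQ k; rewrite ler_norml => /andP[? ?]; apply/andP; split; lra.
have [j jP] := choice ex.
exists [ffun k => j k]; first exact: mem_index_enum.
move=> k; rewrite /= mxE ffunE ler_norml; have /andP[? ?] := jP k.
apply/andP; split; lra.
Qed.

(** Dilating by [lam] pushes a face of a grid cube outwards by
    [(lam - 1) s / 2], and the parallel face of [Q] by the larger amount
    [(lam - 1) l(Q) / 2]. *)
Lemma dilate_grid_cube_sub Q (s delta lam : R) M
    (i : {ffun 'I_d -> 'I_M.+1}) : 0 <= delta -> 1 <= lam ->
  M%:R * delta = side Q - s ->
  cube_set (dilate lam (grid_cube Q s delta i))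
    `<=` cube_set (dilate lam Q).
Proof.
move=> delta0 lam1 MQ; apply: cube_set_sub => k /=; rewrite mxE.
have iM : (i k : 'I_M.+1)%:R * delta <= side Q - s.
  by rewrite -MQ ler_wpM2r// ler_nat -ltnS.
have i0 : 0 <= (i k)%:R * delta by rewrite mulr_ge0.
have sQ : s <= side Q by rewrite -subr_ge0 -MQ mulr_ge0.
have : `|- ((side Q - s) / 2) + (i k)%:R * delta| <= (side Q - s) / 2.
  by rewrite ler_norml; apply/andP; split; lra.
have cancel (c a b : R) : c - a + b - c = - a + b by ring.
rewrite cancel; nra.
Qed.

(** Membership in a grid cube splits into one condition per coordinate, so the
    one-dimensional count is raised to the power [d]. *)
Lemma grid_overlap Q (s delta lam : R) M B y : 0 < delta ->
  lam * s < B%:R * delta ->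
  (#|[pred i : {ffun 'I_d -> 'I_M.+1} |
      y \in cube_set (dilate lam (grid_cube Q s delta i))]| <= B ^ d)%N.
Proof.
move=> delta0 sB.
pose u k := y ord0 k - Defs.center Q ord0 k + (side Q - s) / 2.
pose W k := [pred j : 'I_M.+1 | `|u k - j%:R * delta| <= lam * s / 2].
apply: (@leq_trans #|family (fun k => W k)|).
  apply: subset_leq_card; apply/fintype.subsetP => i; rewrite !inE => yi.
  apply/familyP => k; have := yi k; rewrite /= mxE !inE /u.
  by apply: le_trans; rewrite le_eqVlt; apply/orP; left; apply/eqP; congr `|_|; ring.
rewrite card_family -[d in (B ^ d)%N]card_ord cardE /image_mem.
elim: (enum 'I_d) => //= k e IH; rewrite expnS leq_mul//.
exact: card_grid_window.
Qed.

End grid.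

(** * Least indices and geometric sums *)

Lemma first_natP (P : set nat) : P !=set0 ->
  P (first_nat P) /\ forall j, P j -> (first_nat P <= j)%N.
Proof.
move=> [k Pk]; rewrite /first_nat.
have ex : exists k, `[< P k >] by exists k; apply/asboolP.
case: xgetP => [_ -> //|/(_ (ex_minn ex))[]].
case: ex_minnP => m /asboolP Pm minm; split => // j /asboolP; exact: minm.
Qed.

Lemma geometric_tail_le {R : realType} (q : R) a N : 0 <= q < 1 ->
  \sum_(a <= j < N.+1) q ^+ (N - j) <= (1 - q)^-1.
Proof.
move=> /andP[q0 q1]; have q1' : 0 < 1 - q by lra.
have [aN|Na] := leqP a N; last by rewrite big_geq// invr_ge0 ltW.
elim: N aN => [|N IH] aN.
  by rewrite leqn0 in aN; rewrite (eqP aN) big_nat1 subnn expr0 invf_ge1// gerBl.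
move: aN; rewrite leq_eqVlt => /predU1P[->|aN].
  by rewrite big_nat1 subnn expr0 invf_ge1// gerBl.
rewrite big_nat_recr/=; last exact: leqW.
rewrite subnn expr0.
have -> : \sum_(a <= j < N.+1) q ^+ (N.+1 - j) =
          q * \sum_(a <= j < N.+1) q ^+ (N - j).
  rewrite mulr_sumr; apply: eq_big_nat => j /andP[_ jN].
  by rewrite -exprS subSn.
have -> : (1 - q)^-1 = q * (1 - q)^-1 + 1 by field; rewrite gt_eqF.
by rewrite lerD2r ler_wpM2l// IH.
Qed.

(** * Mass and doubling cubes under the growth condition *)

Section growth_measure.
Context {R : realType} {d : nat}.
Context (mu : {measure set (borelRd R d) -> \bar R}) (n alpha beta C0 : R).
Context (n_gt0 : 0 < n) (n_le_d : n <= d%:R) (C0_gt0 : 0 < C0).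
Context (mu_growth : growth mu n C0).
Context (alpha_gt1 : 1 < alpha) (alpha_lt_beta : alpha ^+ d < beta).
Implicit Types P Q S : cube R d.

Let alpha_gt0 : 0 < alpha. Proof. exact: lt_trans ltr01 _. Qed.
Let alphaX_gt0 k : 0 < alpha ^+ k. Proof. exact: exprn_gt0. Qed.

Let beta_gt1 : 1 < beta.
Proof. by apply: le_lt_trans alpha_lt_beta; rewrite exprn_ege1// ltW. Qed.

Let beta_gt0 : 0 < beta. Proof. exact: lt_trans ltr01 _. Qed.

Let powR_alpha_lt_beta : alpha `^ n < beta.
Proof.
apply: le_lt_trans alpha_lt_beta; rewrite -(powR_mulrn d (ltW alpha_gt0)).
by apply: ler_powR => //; exact: ltW.
Qed.

Lemma cube_fin_num Q : 0 < side Q -> mu (cube_set Q) \is a fin_num.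
Proof.
case: Q => c l /= l0; rewrite ge0_fin_numE//.
by apply: le_lt_trans (mu_growth c l0) _; rewrite ltry.
Qed.

Lemma EFin_mass Q : 0 < side Q -> (mass mu Q)%:E = mu (cube_set Q).
Proof. by move=> Q0; rewrite fineK// cube_fin_num. Qed.

Lemma mass_ge0 Q : 0 <= mass mu Q.
Proof. exact: fine_ge0. Qed.

Lemma mass_le_growth Q : 0 < side Q -> mass mu Q <= C0 * side Q `^ n.
Proof.
by move=> Q0; rewrite -lee_fin EFin_mass//; case: Q Q0 => c l; exact: mu_growth.
Qed.

Lemma le_mass P Q : 0 < side P -> 0 < side Q -> cube_set P `<=` cube_set Q ->
  mass mu P <= mass mu Q.
Proof.
by move=> P0 Q0 PQ; rewrite -lee_fin !EFin_mass// le_measure// inE.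
Qed.

Lemma side_dilate_gt0 k Q : 0 < side Q -> 0 < side (dilate (alpha ^+ k) Q).
Proof. by move=> Q0; rewrite /= mulr_gt0. Qed.

Lemma doublingE Q : 0 < side Q ->
  doubling mu alpha beta Q <-> mass mu (dilate alpha Q) <= beta * mass mu Q.
Proof.
move=> Q0; have aQ0 : 0 < side (dilate alpha Q) by exact: mulr_gt0.
by rewrite /doubling -(EFin_mass Q0) -(EFin_mass aQ0) -EFinM lee_fin.
Qed.

Lemma mass_nondoubling_chain Q i m : 0 < side Q -> (i <= m)%N ->
  (forall k, (i <= k < m)%N ->
     ~ doubling mu alpha beta (dilate (alpha ^+ k) Q)) ->
  beta ^+ (m - i) * mass mu (dilate (alpha ^+ i) Q)
    <= mass mu (dilate (alpha ^+ m) Q).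
Proof.
move=> Q0; elim: m => [|m IH] im nD.
  by rewrite leqn0 in im; rewrite (eqP im) mul1r.
move: im; rewrite leq_eqVlt => /predU1P[->|im]; first by rewrite subnn mul1r.
rewrite subSn// exprS -mulrA.
have := nD m; rewrite -ltnS im leqnn => /(_ isT).
move=> /(doublingE (side_dilate_gt0 m Q0))/negP.
rewrite -ltNge dilate_dilate -exprS => /ltW; apply: le_trans.
rewrite (ler_wpM2l (ltW beta_gt0))//; apply: IH => // k /andP[ik km]; apply: nD.
by rewrite ik ltnW.
Qed.

(** Otherwise the masses of [alpha ^+ N Q] would grow like [beta ^+ N], faster
    than the bound [alpha ^ (n N)] given by the growth condition. *)
Lemma exists_doubling_dilate Q : 0 < side Q -> exists m,
  [/\ (0 < m)%N, doubling mu alpha beta (dilate (alpha ^+ m) Q) &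
   forall i, (0 < i < m)%N -> ~ doubling mu alpha beta (dilate (alpha ^+ i) Q)].
Proof.
move=> Q0.
pose D m := (0 < m)%N && `[< doubling mu alpha beta (dilate (alpha ^+ m) Q) >].
have [[m0 Dm0]|noD] := pselect (exists m, D m).
  case: (ex_minnP (ex_intro _ m0 Dm0)) => m /andP[m1 /asboolP Dm] minm.
  exists m; split => // i /andP[i0 im] Di.
  by have := minm i; rewrite /D i0 leqNgt im => /(_ (introT (asboolP _) Di)).
have {}noD k : (0 < k)%N -> ~ doubling mu alpha beta (dilate (alpha ^+ k) Q).
  by move=> k0 Dk; apply: noD; exists k; rewrite /D k0; exact/asboolP.
(* The mass of alpha^2 Q rather than alpha Q: as alpha Q is not doubling, that
   mass is greater than beta times the mass of alpha Q, hence positive. *)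
suff m2 : mass mu (dilate (alpha ^+ 2) Q) <= 0.
  exfalso; apply: (noD 1%N) => //; apply/doublingE; first exact: side_dilate_gt0.
  rewrite dilate_dilate -exprS; apply: le_trans m2 _.
  by rewrite mulr_ge0 ?mass_ge0// (ltW beta_gt0).
apply: (@le0_of_geometric _ (C0 * (alpha ^+ 2 * side Q) `^ n) (alpha `^ n / beta)).
  by rewrite divr_ge0 ?powR_ge0 ?(ltW beta_gt0)//= ltr_pdivrMr// mul1r.
move=> N; have := @mass_nondoubling_chain Q 2 (N + 2) Q0 (leq_addl _ _).
rewrite addnK => decay; have {}decay := le_trans
  (decay (fun k kN => noD k (ltnW (proj1 (andP kN)))))
  (mass_le_growth (side_dilate_gt0 _ Q0)).
move: decay; rewrite mulrC -ler_pdivlMr ?exprn_gt0// => /le_trans; apply.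
rewrite /= exprD -mulrA.
rewrite powRM ?mulr_ge0 ?(ltW alpha_gt0) ?(ltW (alphaX_gt0 _)) ?(ltW Q0)//.
rewrite exprMn exprVn.
rewrite -[alpha ^+ N](powR_mulrn N (ltW alpha_gt0)) powRAC powR_mulrn ?powR_ge0//.
by rewrite le_eqVlt; apply/orP; left; apply/eqP; ring.
Qed.

(** The masses of concentric nondoubling cubes grow at least like the power
    [b] of the side, with [alpha `^ b = beta]; the gap between [b] and [n] is
    what makes the sums below converge. *)
Definition doubling_exponent : R := ln beta / ln alpha.
Local Notation b := doubling_exponent.

Let ln_alpha_gt0 : 0 < ln alpha. Proof. exact: ln_gt0. Qed.

Lemma powR_doubling_exponent : alpha `^ b = beta.
Proof.
rewrite /powR gt_eqF// /b divfK ?gt_eqF// lnK//.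
Qed.

Lemma n_lt_doubling_exponent : n < b.
Proof.
rewrite /b ltr_pdivlMr// -ln_powR ltr_ln// posrE; exact: powR_gt0.
Qed.

(** * The coefficients K across a range of nondoubling cubes *)

Lemma powR_ratio_split (a p t : R) : 0 < a -> 0 < p -> 0 < t ->
  a `^ b * (p / t) `^ (b - n) = (a * p / t) `^ b * (t `^ n / p `^ n).
Proof.
move=> a0 p0 t0; have pt0 : 0 < p / t by exact: divr_gt0.
rewrite powRD ?(gt_eqF pt0) ?implybT// powRN mulrA -powRM ?(ltW a0) ?(ltW pt0)//.
rewrite -mulrA; congr (_ * _).
have -> : p `^ n = (p / t) `^ n * t `^ n.
  by rewrite -powRM ?(ltW pt0) ?(ltW t0)// divfK// gt_eqF.
by field; rewrite !gt_eqF//; exact: powR_gt0.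
Qed.

(** With T = alpha^m S, the cube [P] lies in a dilate alpha^i S of comparable
    side.  If [i <= m], there are [m - i] nondoubling steps from there to T,
    which make the mass of [P] smaller than that of T by a power [b] of the
    ratio of the sides, up to a constant; growth bounds the mass of T.  If [i > m], then [P] has
    at least about the side of T and growth alone suffices. *)
Lemma nondoubling_density_le P S m : 0 < side S -> side S <= side P ->
  (forall k, `|Defs.center P ord0 k - Defs.center S ord0 k| <= side S / 2) ->
  (forall i, (0 < i < m)%N ->
     ~ doubling mu alpha beta (dilate (alpha ^+ i) S)) ->
  mass mu P / side P `^ n <=
    C0 * ((2 * alpha) `^ b * (side P / side (dilate (alpha ^+ m) S)) `^ (b - n)).
Proof.
move=> S0 SP PS nD; set T := dilate (alpha ^+ m) S.
have P0 : 0 < side P by exact: lt_le_trans SP.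
have T0 : 0 < side T by exact: side_dilate_gt0.
have nb : n <= b by exact/ltW/n_lt_doubling_exponent.
have b0 : 0 <= b by exact: le_trans (ltW n_gt0) nb.
have a2 : 0 < 2 * alpha by rewrite mulr_gt0.
(* The cube concentric with S of side 2 l(P) contains P. *)
have [i0 Pi0] := exprn_large (2 * side P / side S) alpha_gt1.
case: (ex_minnP (ex_intro (fun i => 2 * side P / side S < alpha ^+ i) _ Pi0)).
move=> {i0 Pi0} i; rewrite ltr_pdivrMr// => Pi mini.
have i_gt0 : (0 < i)%N.
  rewrite lt0n; apply/eqP => i0; move: Pi; rewrite i0 expr0 mul1r.
  by apply/negP; rewrite -leNgt; lra.
have Pi' : alpha ^+ i.-1 * side S <= 2 * side P.
  rewrite -ler_pdivlMr// leNgt; apply/negP => /mini.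
  by rewrite -ltnS prednK// ltnn.
rewrite powR_ratio_split// mulrA [leRHS]mulrA ler_pM2r ?invr_gt0 ?powR_gt0//.
set Y := 2 * alpha * side P / side T.
have Y0 : 0 < Y by rewrite divr_gt0// mulr_gt0.
have [im|mi] := leqP i m.
  have Si0 : 0 < side (dilate (alpha ^+ i) S) by exact: side_dilate_gt0.
  have PSi : mass mu P <= mass mu (dilate (alpha ^+ i) S).
    apply: le_mass => //; apply: cube_set_sub => k /=.
    by have := PS k; lra.
  have decay : beta ^+ (m - i) * mass mu P <= C0 * side T `^ n.
    apply: le_trans (mass_le_growth T0).
    apply: le_trans (mass_nondoubling_chain S0 im _).
      by rewrite ler_pM2l ?exprn_gt0.
    by move=> k /andP[ik km]; apply: nD; rewrite (leq_trans i_gt0).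
  have Y1 : 1 <= beta ^+ (m - i) * Y `^ b.
    have -> : beta ^+ (m - i) = (alpha ^+ (m - i)) `^ b.
      rewrite -(powR_mulrn _ (ltW alpha_gt0)) powRAC powR_doubling_exponent.
      by rewrite powR_mulrn// ltW.
    rewrite -powRM ?(ltW Y0) ?(ltW (alphaX_gt0 _))//.
    apply: le_trans (_ : 1 `^ b <= _); first by rewrite powR1.
    apply: ge0_ler_powR => //.
    - by rewrite nnegrE.
    - by rewrite nnegrE mulr_ge0 ?(ltW Y0) ?(ltW (alphaX_gt0 _)).
    rewrite /Y mulrA ler_pdivlMr// mul1r /T /=.
    have -> : alpha ^+ m = alpha ^+ (m - i) * (alpha * alpha ^+ i.-1).
      by rewrite -exprS prednK// -exprD subnK.
    by rewrite -!mulrA ler_pM2l// [leRHS]mulrCA ler_pM2l.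
  apply: le_trans (_ : mass mu P * (beta ^+ (m - i) * Y `^ b) <= _).
    by rewrite ler_peMr ?mass_ge0.
  by rewrite mulrCA mulrA [leRHS]mulrAC ler_wpM2r ?powR_ge0.
have Ti : side T <= 2 * side P.
  apply: le_trans Pi'; rewrite ler_pM2r// ler_weXn2l ?(ltW alpha_gt1)//.
  by rewrite -ltnS prednK.
apply: (le_trans (mass_le_growth P0)).
rewrite -mulrA ler_pM2l//.
have PY : side P <= Y * side T.
  rewrite /Y divfK ?gt_eqF// ler_peMl ?(ltW P0)//.
  by rewrite mulr_ege1 ?ler1n// ltW.
apply: (@le_trans _ _ ((Y * side T) `^ n)).
  apply: (ge0_ler_powR (ltW n_gt0)) => //; rewrite nnegrE; first exact: ltW.
  by rewrite mulr_ge0// ltW.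
rewrite powRM ?(ltW Y0) ?(ltW T0)// ler_pM2r ?powR_gt0//; apply: ler_powR => //.
rewrite /Y ler_pdivlMr// mul1r (le_trans Ti)// [leRHS]mulrAC ler_peMr ?(ltW alpha_gt1)//.
by rewrite mulr_ge0// ltW.
Qed.

Lemma N_QRP P S : 0 < side P ->
  side S <= side (dilate (2 ^+ N_QR P S) P) /\
  forall k, side S <= side (dilate (2 ^+ k) P) -> (N_QR P S <= k)%N.
Proof.
move=> P0; rewrite /N_QR; set A := [set k | _].
suff [] : A (first_nat A) /\ forall k, A k -> (first_nat A <= k)%N by [].
apply: first_natP; have [k /ltW] := exprn_large (side S / side P) (ltr1n R 2).
by rewrite ler_pdivrMr// => ?; exists k.
Qed.

Lemma K_QR_ge1 P S : 1 <= K_QR mu n P S.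
Proof.
by rewrite /K_QR lerDl sumr_ge0// => k _; rewrite divr_ge0 ?mass_ge0 ?powR_ge0.
Qed.

Lemma le_K_QR P S T : 0 < side P -> side S <= side T ->
  K_QR mu n P S <= K_QR mu n P T.
Proof.
move=> P0 ST; have [_ minS] := N_QRP S P0; have [TN _] := N_QRP T P0.
rewrite /K_QR lerD2l [leRHS](big_cat_nat (n := (N_QR P S).+1))//=; last first.
  by rewrite ltnS; apply: minS; exact: le_trans TN.
by rewrite lerDl sumr_ge0// => k _; rewrite divr_ge0 ?mass_ge0 ?powR_ge0.
Qed.

Definition skips_nondoubling (C1 : R) : Prop :=
  forall P S m, 0 < side P -> 0 < side S -> cube_set P `<=` cube_set S ->
    (forall i, (0 < i < m)%N ->
       ~ doubling mu alpha beta (dilate (alpha ^+ i) S)) ->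
    K_QR mu n P (dilate (alpha ^+ m) S) <= K_QR mu n P S + C1.

(** Only the terms with [N_QR P S < j <= N_QR P T] are new, and by
    [nondoubling_density_le] they are bounded by the terms of a geometric
    series whose largest term is the one with [j = N_QR P T]. *)
Lemma K_QR_skip_nondoubling : exists2 C1, 0 <= C1 & skips_nondoubling C1.
Proof.
have nb := n_lt_doubling_exponent.
pose q : R := 2^-1 `^ (b - n).
have q01 : 0 <= q < 1.
  rewrite powR_ge0/= /q /powR gt_eqF// expR_lt1 pmulr_rlt0 ?subr_gt0//.
  by rewrite ln_lt0//; lra.
pose D := C0 * ((2 * alpha) `^ b * 2 `^ (b - n)).
have D0 : 0 <= D by rewrite !mulr_ge0 ?powR_ge0// ltW.
exists (D * (1 - q)^-1).
  by rewrite mulr_ge0// invr_ge0; lra.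
move=> P S m P0 S0 PS nD; set T := dilate _ S.
have T0 : 0 < side T by exact: side_dilate_gt0.
have PSc k : `|Defs.center P ord0 k - Defs.center S ord0 k| <= side S / 2.
  by apply: PS => i; rewrite subrr normr0 divr_ge0// ltW.
have [SN minSN] := N_QRP S P0; have [TN minTN] := N_QRP T P0.
rewrite /K_QR; set NT := N_QR P T; set NS := N_QR P S.
have NST : (NS <= NT)%N.
  apply: minSN; apply: le_trans TN.
  by rewrite ler_peMl ?(ltW S0)// exprn_ege1// ltW.
rewrite -addrA lerD2l (big_cat_nat (n := NS.+1))//= lerD2l.
apply: le_trans (_ : D * \sum_(NS.+1 <= j < NT.+1) q ^+ (NT - j) <= _); last first.
  by rewrite ler_wpM2l// geometric_tail_le.
rewrite mulr_sumr ler_sum_nat// => j /andP[NSj jNT].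
have two_gt0 k : 0 < 2 ^+ k :> R by exact: exprn_gt0.
have SPj : side S <= side (dilate (2 ^+ j) P).
  apply: le_trans SN _; rewrite ler_pM2r// ler_weXn2l ?ler1n//.
  exact: ltnW.
apply: le_trans (nondoubling_density_le S0 SPj PSc nD) _.
rewrite /D -[leRHS]mulrA ler_pM2l// -[leRHS]mulrA ler_pM2l ?powR_gt0 ?mulr_gt0//.
have -> : 2 `^ (b - n) * q ^+ (NT - j) = (2 * 2^-1 ^+ (NT - j)) `^ (b - n).
  by rewrite powRM ?exprn_ge0// /q -powR_mulrn ?powR_ge0// powRAC powR_mulrn.
apply: ge0_ler_powR.
- by rewrite subr_ge0 ltW.
- by rewrite nnegrE divr_ge0// ltW// mulr_gt0.
- by rewrite nnegrE mulr_ge0.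
have NT_gt0 : (0 < NT)%N by exact: leq_ltn_trans (leq0n _) (leq_trans NSj jNT).
(* The least index reaching side T: the previous one does not. *)
have Tlt : side (dilate (2 ^+ NT.-1) P) < side T.
  rewrite ltNge; apply/negP => /minTN; rewrite -ltnS prednK// ltnn//.
rewrite ler_pdivrMr//= exprVn mulrAC ler_pdivlMr//.
apply: le_trans (_ : 2 * (2 ^+ NT.-1 * side P) <= _); last by rewrite ler_pM2l// ltW.
rewrite mulrAC -exprD mulrA -exprS prednK// subnKC//.
Qed.

(** * Existence of good centres *)

(** The closed cube is the intersection of its enlargements, which have finite
    mass. *)
Lemma le_mass_of_enlarged (x : 'rV[R]_d) (s C a : R) : 0 < s -> 0 <= C ->
  (forall e, 0 < e -> a <= C * mass mu (Cube x (s + e))) ->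
  a <= C * mass mu (Cube x s).
Proof.
move=> s0 C0' ae.
have se0 k : 0 < s + k.+1%:R^-1 by rewrite addr_gt0.
pose F (k : nat) : set (borelRd R d) := cube_set (Cube x (s + k.+1%:R^-1)).
have FE : \bigcap_k F k = cube_set (Cube x s).
  apply/seteqP; split=> [y Fy i|y ys k _].
    rewrite /=; apply/ler_addgt0Pr => e e0.
    have := Fy (Num.truncn e^-1) I i; rewrite /= mulrDl => /le_trans; apply.
    rewrite lerD2l ler_pdivrMr// (le_trans (y := e))//; last by lra.
    by rewrite invf_ple ?posrE// ltW// truncnS_gt.
  by apply: (cube_set_sub _ ys) => i /=; rewrite subrr normr0 add0r ler_pM2r// lerDl.
have cvgF : (mu \o F) @ \oo --> mu (cube_set (Cube x s)).
  rewrite -FE; apply: nonincreasing_cvg_mu.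
  - by rewrite ltey_eq (cube_fin_num (se0 0%N : 0 < side (Cube x _))).
  - by move=> k; exact: measurable_cube_set.
  - by rewrite FE.
  apply/nonincreasing_seqP => k; apply/subsetPset/cube_set_sub => i /=.
  rewrite subrr normr0 add0r ler_pM2r// lerD2l lef_pV2 ?posrE//.
  by rewrite ler_nat.
have [CE|Cn0] := eqVneq C 0.
  by have := ae 1 ltr01; rewrite CE !mul0r.
have Cgt0 : 0 < C by rewrite lt0r Cn0.
rewrite mulrC -ler_pdivrMr// -lee_fin EFin_mass// -(cvg_lim _ cvgF)//.
apply: lime_ge; first by apply/cvg_ex; eexists; exact: cvgF.
apply: nearW => k /=; rewrite -(EFin_mass (se0 k : 0 < side (Cube x _))).
by rewrite lee_fin ler_pdivrMr// mulrC; apply: ae; rewrite invr_gt0.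
Qed.

(** If all centres in the cube Q0 of side [e] around [x] were bad, the cubes of
    side alpha^-N l centred in Q0 would have mass at most a constant times
    beta^-N.  About alpha^(Nd) of them cover Q0, so Q0 has mass 0.  But then [x]
    itself is good, since a small cube around it is doubling as its
    alpha-dilate has mass 0. *)
Lemma exists_inner_doubling_near (x : 'rV[R]_d) (e l : R) : 0 < e -> 0 < l ->
  exists2 y : 'rV[R]_d, forall k, `|y ord0 k - x ord0 k| <= e / 2 &
    inner_doubling mu alpha beta (Cube y l) !=set0.
Proof.
move=> e0 l0; apply: contrapT => none.
have aVX_gt0 N : 0 < alpha ^- N by rewrite invr_gt0.
have nD (y : 'rV[R]_d) N : (forall k, `|y ord0 k - x ord0 k| <= e / 2) -> (0 < N)%N ->
    ~ doubling mu alpha beta (dilate (alpha ^- N) (Cube y l)).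
  by move=> yx N0 DN; apply: none; exists y => //; exists N.
have decay (y : 'rV[R]_d) N : (forall k, `|y ord0 k - x ord0 k| <= e / 2) ->
    mass mu (dilate (alpha ^- N) (Cube y l)) <= C0 * l `^ n / beta ^+ N.
  move=> yx; set P := dilate _ _.
  have P0 : 0 < side P by rewrite mulr_gt0.
  have undilate k : (k <= N)%N -> dilate (alpha ^+ k) P =
      dilate (alpha ^- (N - k)) (Cube y l).
    move=> kN; rewrite /P dilate_dilate; congr dilate.
    by rewrite -{1}(subnK kN) exprD invfM mulrCA divff ?mulr1// gt_eqF.
  rewrite ler_pdivlMr ?exprn_gt0// mulrC.
  have := @mass_nondoubling_chain P 0 N P0 (leq0n N).
  rewrite subn0 dilate1 undilate// subnn invr1 dilate1 => /(_ _)/le_trans.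
  apply; last exact: (@mass_le_growth (Cube y l)).
  move=> k /= kN; rewrite undilate; last exact: ltnW.
  by apply: nD; rewrite // subn_gt0.
pose Q0 := Cube x e.
have mass_le N : mass mu Q0 <=
    ((e / l + 1) ^+ d * (C0 * l `^ n)) * (alpha ^+ d / beta) ^+ N.
  pose M := Num.truncn (e * alpha ^+ N / l).
  pose s := e / M.+1%:R.
  have s0 : 0 < s by rewrite divr_gt0.
  have MsE : M%:R * s = side Q0 - s.
    by rewrite /= /s -natr1; field; rewrite natr1.
  have cell_center i k :
      `|Defs.center (grid_cube Q0 s s (i : {ffun 'I_d -> 'I_M.+1})) ord0 k
        - x ord0 k| <= e / 2.
    have iM : (i k)%:R * s <= e - s.
      by rewrite -[e](_ : side Q0 = e)// -MsE ler_wpM2r ?(ltW s0)// ler_nat -ltnS.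
    have i0 : 0 <= (i k)%:R * s by rewrite mulr_ge0// ltW.
    by rewrite /= mxE ler_norml /=; apply/andP; split; lra.
  have cell_mass i : (mu (cube_set (grid_cube Q0 s s (i : {ffun 'I_d -> 'I_M.+1})))
      <= (C0 * l `^ n / beta ^+ N)%:E)%E.
    rewrite -EFin_mass// lee_fin.
    apply: le_trans (decay _ N (cell_center i)); apply: le_mass => //=.
      by rewrite mulr_gt0.
    apply: cube_set_sub => k /=; rewrite subrr normr0 add0r ler_pM2r//.
    have := ltW (truncnS_gt (e * alpha ^+ N / l)); rewrite ler_pdivrMr// => MN.
    by rewrite /s ler_pdivrMr// -mulrA ler_pdivlMl// mulrC [leRHS]mulrC.
  rewrite -lee_fin EFin_mass//.
  have ss : s <= s by [].
  apply: (le_trans (measure_cover mu _ _ (grid_cover ss MsE))) => //.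
  apply: (le_trans (lee_sum _ (fun i _ => cell_mass i))).
  rewrite sumEFin lee_fin sumr_const card_ffun !card_ord.
  have MN : M.+1%:R <= (e / l + 1) * alpha ^+ N.
    rewrite -natr1 mulrDl mul1r lerD ?exprn_ege1 ?(ltW alpha_gt1)//.
    rewrite mulrAC truncn_le divr_ge0 ?mulr_ge0 ?(ltW e0) ?(ltW l0)//.
    exact: ltW.
  rewrite -mulr_natr natrX.
  have := lerXn2r d _ _ MN; rewrite !nnegrE ler0n => /(_ isT).
  rewrite mulr_ge0 ?addr_ge0 ?divr_ge0 ?(ltW e0) ?(ltW l0) ?(ltW (alphaX_gt0 _))//.
  move=> /(_ isT) MNd.
  apply: (@le_trans _ _ (C0 * l `^ n / beta ^+ N * ((e / l + 1) * alpha ^+ N) ^+ d)).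
    rewrite ler_wpM2l// divr_ge0 ?mulr_ge0 ?powR_ge0 ?(ltW C0_gt0)//.
    by rewrite exprn_ge0// ltW.
  rewrite !exprMn exprVn -!exprM [(N * d)%N]mulnC.
  by rewrite le_eqVlt; apply/orP; left; apply/eqP; ring.
have Q0_le0 : mass mu Q0 <= 0.
  apply: le0_of_geometric mass_le.
  rewrite divr_ge0 ?(ltW (alphaX_gt0 _)) ?(ltW beta_gt0)//=.
  by rewrite ltr_pdivrMr// mul1r.
have [N lN] := exprn_large (l / e) alpha_gt1.
have xx (k : 'I_d) : `|x ord0 k - x ord0 k| <= e / 2.
  by rewrite subrr normr0 divr_ge0// ltW.
apply: (nD x N.+1 xx) => //; apply/doublingE; first by rewrite /= mulr_gt0.
apply: le_trans (_ : 0 <= _); last by rewrite mulr_ge0 ?mass_ge0// ltW.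
apply: le_trans Q0_le0; apply: le_mass => //; first by rewrite /= !mulr_gt0.
apply: cube_set_sub => k /=; rewrite subrr normr0 add0r ler_pM2r//.
rewrite mulrA exprS invfM mulrA divff ?gt_eqF// mul1r.
by rewrite ler_pdivrMl// mulrC -ler_pdivrMl// mulrC ltW.
Qed.

(** * Integrals over large cubes *)

(** If the first doubling cube found below T = alpha^m S is no larger than S,
    then T' has side at most 1; the cube alpha^-j S guarantees that T' exists. *)
Lemma dilate_scriptQ_ex S m j : 0 < side S -> side S <= 1 ->
  (0 < m)%N ->
  (forall i, (0 < i < m)%N ->
     ~ doubling mu alpha beta (dilate (alpha ^+ i) S)) ->
  doubling mu alpha beta (dilate (alpha ^- j) S) ->
  scriptQ_ex mu alpha beta (dilate (alpha ^+ m) S).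
Proof.
move=> S0 S1 m0 nD Dj; set T := dilate _ S.
have inner : inner_doubling mu alpha beta T !=set0.
  exists (m + j)%N; split; first by rewrite addn_gt0 m0.
  rewrite /T dilate_dilate exprD invfM mulrC mulrA divff ?gt_eqF// mul1r.
  exact: Dj.
have [[N0 DN] _] := first_natP inner.
split => //; first exact: side_dilate_gt0.
rewrite /primeQ /=; set N := first_nat _ in N0 DN *.
have mN : (m <= N)%N.
  rewrite leqNgt; apply/negP => Nm; apply: (nD (m - N)%N).
    by rewrite subn_gt0 Nm ltn_subrL N0.
  move: DN; rewrite /T dilate_dilate.
  by rewrite -{1}(subnK (ltnW Nm)) exprD mulrCA mulVf ?mulr1// gt_eqF.
rewrite ler_pdivrMl// mulr1; apply: le_trans (_ : alpha ^+ m <= _).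
  by rewrite ler_piMr// ltW.
by rewrite ler_weXn2l// ltW.
Qed.

Section local_integrals.
Context (f : borelRd R d -> R) (f_loc : loc_integrable mu f).

Definition abs_int Q : R := \int[mu]_(x in cube_set Q) `|f x|.

Let integrable_cube Q : mu.-integrable (cube_set Q) (EFin \o f).
Proof. by case: f_loc => _; apply; exact: compact_cube_set. Qed.

Let measurable_abs : measurable_fun setT (fun x => `|f x|%:E).
Proof.
apply/measurable_EFinP; apply: measurableT_comp => //.
by case: f_loc.
Qed.

Lemma EFin_abs_int Q :
  (abs_int Q)%:E = (\int[mu]_(x in cube_set Q) `|f x|%:E)%E.
Proof.
rewrite fineK//; apply: integrable_fin_num => //.
exact: integrable_norm (integrable_cube Q).
Qed.

Lemma le_abs_int P Q : cube_set P `<=` cube_set Q -> abs_int P <= abs_int Q.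
Proof.
move=> PQ; rewrite -lee_fin !EFin_abs_int; apply: ge0_subset_integral => //.
exact: measurable_funTS.
Qed.

Lemma abs_int_cover (I : finType) Q (F : I -> cube R d) :
  cube_set Q `<=` \bigcup_(i in [set` index_enum I]) cube_set (F i) ->
  abs_int Q <= \sum_i abs_int (F i).
Proof.
move=> QF; rewrite -lee_fin EFin_abs_int -sumEFin.
rewrite (eq_bigr _ (fun i _ => EFin_abs_int (F i))).
exact: integral_cover.
Qed.

Lemma abs_int_null Q : 0 < side Q -> mass mu Q = 0 -> abs_int Q = 0.
Proof.
move=> Q0 mQ; apply: EFin_inj; rewrite EFin_abs_int null_set_integral//.
  exact: measurable_funTS.
by rewrite -EFin_mass// mQ.
Qed.

Lemma le_normr_mean Q : `|mean mu Q f| <= (mass mu Q)^-1 * abs_int Q.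
Proof.
rewrite /mean normrM ger0_norm ?invr_ge0 ?mass_ge0// ler_wpM2l//.
  by rewrite invr_ge0 mass_ge0.
exact: le_normr_Rintegral.
Qed.

Section large_cubes.
Context (eta : R) (eta_gt1 : 1 < eta) (eta_le_alpha : eta <= alpha).

Let eta_gt0 : 0 < eta. Proof. exact: lt_trans ltr01 _. Qed.

Lemma abs_int_le_of_quot Q C : 0 < side Q ->
  (0 < mass mu (dilate eta Q) -> abs_quot mu eta Q f <= C) ->
  abs_int Q <= C * mass mu (dilate eta Q).
Proof.
move=> Q0 quotC.
have eQ0 : 0 < side (dilate eta Q) by exact: mulr_gt0.
have := mass_ge0 (dilate eta Q); rewrite le_eqVlt => /predU1P[m0|m_gt0].
  rewrite -m0 mulr0 abs_int_null//; apply/le_anti; rewrite mass_ge0 andbT.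
  rewrite m0; apply: le_mass => //; rewrite -[X in cube_set X](dilate1 Q).
  by apply: dilate_sub; exact: ltW.
by rewrite mulrC -ler_pdivrMl//; exact: quotC.
Qed.

Context (C : R) (C_ge0 : 0 <= C).
Context (quot_le : forall Q,
  (scriptQ_ex mu alpha beta `\` @scriptQ R d) Q ->
  0 < mass mu (dilate eta Q) -> abs_quot mu eta Q f <= C).

(** A cube P with side in ]1, alpha] and good centre belongs to [scriptQ_ex],
    because P' is smaller than P by a factor alpha at least.  Moving the centre
    of [Q] to a good one at distance at most e / 2 and enlarging the side by e
    gives such a cube containing [Q]; let e tend to 0. *)
Lemma abs_int_le_medium Q : 1 < side Q -> side Q < alpha ->
  abs_int Q <= C * mass mu (dilate eta Q).
Proof.
case: Q => x l /= l1 la; have l0 : 0 < l by lra.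
rewrite /dilate /=; apply: le_mass_of_enlarged => //; first exact: mulr_gt0.
move=> e' e'0.
(* The first bound places eta P in the enlarged cube, the second keeps l(P)
   below alpha. *)
pose e := Order.min (e' / (eta + 1)) ((alpha - l) / 2).
have e0 : 0 < e.
  by rewrite lt_min; apply/andP; split; apply: divr_gt0; rewrite ?subr_gt0 ?addr_gt0.
have ee' : e * (eta + 1) <= e'.
  by rewrite -ler_pdivlMr ?addr_gt0// ge_min lexx.
have ela : l + e <= alpha.
  have : e <= (alpha - l) / 2 by rewrite ge_min lexx orbT.
  by lra.
have le0 : 0 < l + e by rewrite addr_gt0.
have [y yx goody] := exists_inner_doubling_near x e0 le0.
pose P := Cube y (l + e).
have Pex : (scriptQ_ex mu alpha beta `\` @scriptQ R d) P.
  split; last by move=> [_] /=; apply/negP; rewrite -ltNge ltr_wpDr// ltW.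
  split => //; have [[N0 _] _] := first_natP goody.
  rewrite /primeQ /= ler_pdivrMl// mulr1 (le_trans ela)//.
  by rewrite -[leLHS]expr1 ler_weXn2l// ltW.
apply: (@le_trans _ _ (abs_int P)).
  apply: le_abs_int; apply: cube_set_sub => k /=.
  by rewrite distrC mulrDl addrC lerD2l yx.
apply: (le_trans (abs_int_le_of_quot _ (quot_le Pex))) => //.
rewrite ler_wpM2l//; apply: le_mass => //=; rewrite ?addr_gt0 ?mulr_gt0//.
apply: cube_set_sub => k /=; apply: (le_trans (lerD (yx k) (lexx _))).
by move: ee'; rewrite mulrDr mulr1 mulrDr [e * eta]mulrC; lra.
Qed.

(** With s = (1 + alpha) / 2, the grid used for cubes of side at least alpha has
    step at least s (1 - s / alpha), so that in each direction at most this
    many eta-dilates meet a given point. *)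
Definition large_overlap : nat :=
  (Num.truncn (eta / (1 - (1 + alpha) / 2 / alpha))).+1.

(** Subdividing [Q] into equal cubes would not do: for [alpha] close to 1 no
    integer quotient of [side Q] need lie between 1 and [alpha].  The grid cubes
    have the fixed side (1 + alpha) / 2 instead, and overlap. *)
Lemma abs_int_le_large Q : alpha <= side Q ->
  abs_int Q <= C * (large_overlap ^ d)%:R * mass mu (dilate eta Q).
Proof.
move=> aQ; pose s : R := (1 + alpha) / 2; pose l := side Q.
have l0 : 0 < l by exact: lt_le_trans aQ.
have s1 : 1 < s by rewrite /s; have := alpha_gt1; lra.
have s0 : 0 < s by exact: lt_trans ltr01 _.
have sa : s < alpha by rewrite /s; have := alpha_gt1; lra.
have sl : s < l by exact: lt_le_trans aQ.
(* The least convenient number of steps: step at most s, yet not much smaller,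
   since l exceeds s by the fixed factor alpha / s. *)
pose M := (Num.truncn ((l - s) / s)).+1.
pose delta := (l - s) / M%:R.
have M0 : 0 < M%:R :> R by rewrite ltr0n.
have delta0 : 0 < delta by rewrite divr_gt0// subr_gt0.
have MQ : M%:R * delta = side Q - s by rewrite mulrC divfK// gt_eqF.
have ds : delta <= s.
  rewrite ler_pdivrMr// mulrC -ler_pdivrMr//; exact/ltW/truncnS_gt.
have lM : M%:R <= l / s.
  rewrite -natr1 -[leRHS](subrK 1) lerD2r.
  have -> : l / s - 1 = (l - s) / s by field; rewrite gt_eqF.
  by rewrite truncn_le divr_ge0// ltW// subr_gt0.
have sd : s * (1 - s / alpha) <= delta.
  rewrite /delta ler_pdivlMr//.
  apply: le_trans (_ : s * (1 - s / l) * (l / s) <= _); last first.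
    by rewrite le_eqVlt; apply/orP; left; apply/eqP; field; rewrite !gt_eqF.
  have sla : 1 - s / alpha <= 1 - s / l.
    by rewrite lerD2l lerN2 ler_pM2l// lef_pV2 ?posrE.
  have sa0 : 0 <= 1 - s / alpha by rewrite subr_ge0 ler_pdivrMr// mul1r ltW.
  apply: ler_pM => //; first by rewrite mulr_ge0// ltW.
  by rewrite ler_pM2l.
have overlap : eta * s < large_overlap%:R * delta.
  have sa1 : 0 < 1 - s / alpha by rewrite subr_gt0 ltr_pdivrMr// mul1r.
  apply: lt_le_trans (_ : large_overlap%:R * (s * (1 - s / alpha)) <= _); last first.
    by rewrite ler_wpM2l.
  rewrite [ltRHS]mulrCA [ltLHS]mulrC ltr_pM2l// -ltr_pdivrMr//.
  exact: truncnS_gt.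
apply: le_trans (abs_int_cover (grid_cover ds MQ)) _.
pose F (i : {ffun 'I_d -> 'I_M.+1}) := dilate eta (grid_cube Q s delta i).
have eQ0 : 0 < side (dilate eta Q) by exact: mulr_gt0.
have F0 i : 0 < side (F i) by exact: mulr_gt0.
apply: le_trans (_ : \sum_i C * mass mu (F i) <= _).
  by apply: ler_sum => i _; exact: abs_int_le_medium.
rewrite -mulr_sumr -mulrA ler_wpM2l// -lee_fin -sumEFin EFinM EFin_mass//.
rewrite (eq_bigr _ (fun i _ => EFin_mass (F0 i))).
apply: measure_overlap => // [i|y _]; last exact: grid_overlap.
by apply: dilate_grid_cube_sub MQ; exact: ltW.
Qed.

Lemma normr_mean_doubling_le Q C' : 0 < side Q -> doubling mu alpha beta Q ->
  0 < mass mu Q -> 0 <= C' -> abs_int Q <= C' * mass mu (dilate eta Q) ->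
  `|mean mu Q f| <= C' * beta.
Proof.
move=> Q0 /(doublingE Q0) DQ mQ C'0 intQ; apply: le_trans (le_normr_mean _) _.
rewrite ler_pdivrMl//; apply: (le_trans intQ); rewrite mulrCA ler_wpM2l//.
rewrite mulrC; apply: le_trans DQ; apply: le_mass; rewrite ?mulr_gt0//.
by apply: dilate_sub => //; exact: ltW.
Qed.

Lemma abs_int_le_big Q : 1 < side Q ->
  abs_int Q <= C * (large_overlap ^ d)%:R * mass mu (dilate eta Q).
Proof.
move=> Q1; have [|/abs_int_le_medium medQ] := leP alpha (side Q).
  exact: abs_int_le_large.
apply: (le_trans (medQ Q1)); rewrite ler_wpM2r ?mass_ge0// ler_peMr//.
by rewrite ler1n expn_gt0.
Qed.

End large_cubes.
End local_integrals.

(** * Comparison of the two sets of conditions *)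

Section comparison.
Context (eta : R) (eta_gt1 : 1 < eta) (eta_le_alpha : eta <= alpha).
Local Notation bound1 := (rbmo1_bound mu n alpha beta eta).
Local Notation bound := (rbmo_bound mu n alpha beta eta).

Lemma rbmo1_bound_of_rbmo_bound f C : bound f C -> bound1 f C.
Proof.
move=> [C0' oscC meanC absC]; split => //.
- by move=> Q [Q0 Q1]; exact: oscC.
- by move=> Q S [Q0 Q1] [S0 _ _]; exact: meanC.
move=> Q [[Q0 _ _] Q1]; apply: absC => //.
by rewrite ltNge; apply/negP => Qle; apply: Q1.
Qed.

(** [S] need not belong to [scriptQ_ex], but its first doubling dilate T does:
    the cube T' is [S].  Compare both means with the mean over T. *)
Lemma mean_dist_le_small C1 f C Q S : 0 <= C1 -> skips_nondoubling C1 ->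
  bound1 f C -> 0 < side Q -> 0 < side S -> side Q <= 1 -> side S <= 1 ->
  doubling mu alpha beta Q -> doubling mu alpha beta S ->
  cube_set Q `<=` cube_set S -> 0 < mass mu Q -> 0 < mass mu S ->
  `|mean mu Q f - mean mu S f| <= (2 + 2 * C1) * C * K_QR mu n Q S.
Proof.
move=> C1_ge0 skip [C_ge0 _ meanC _] Q0 S0 Q1 S1 DQ DS QS mQ mS.
have [m [m0 DT nD]] := exists_doubling_dilate S0.
set T := dilate (alpha ^+ m) S in DT.
have T0 : 0 < side T by exact: side_dilate_gt0.
have ST : cube_set S `<=` cube_set T.
  rewrite -[X in cube_set X `<=` _](dilate1 S).
  apply: dilate_sub; first exact: ltW.
  by rewrite exprn_ege1// ltW.
have Tex : scriptQ_ex mu alpha beta T.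
  by apply: (@dilate_scriptQ_ex S m 0%N) => //; rewrite expr0 invr1 dilate1.
have mT : 0 < mass mu T by apply: lt_le_trans mS _; exact: le_mass.
have QT := meanC Q T (conj Q0 Q1) Tex DQ DT (subset_trans QS ST) mQ mT.
have SmT := meanC S T (conj S0 S1) Tex DS DT ST mS mT.
have KQ := skip Q S m Q0 S0 QS nD.
have KS := skip S S m S0 S0 (@subset_refl _ _) nD.
have KSS : K_QR mu n S S = 1.
  rewrite /K_QR; have [_ /(_ 0%N)] := N_QRP S S0.
  by rewrite dilate1 lexx leqn0 => /(_ isT)/eqP ->; rewrite big_geq// addr0.
rewrite KSS in KS; have KQS := K_QR_ge1 Q S.
have -> : mean mu Q f - mean mu S f =
    (mean mu Q f - mean mu T f) - (mean mu S f - mean mu T f) by ring.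
apply: (le_trans (ler_normB _ _)); apply: (le_trans (lerD QT SmT)).
rewrite -mulrDr [_ * C]mulrC -mulrA ler_wpM2l//.
apply: (le_trans (lerD KQ KS)).
have : C1 * 1 <= C1 * K_QR mu n Q S by exact: ler_wpM2l.
rewrite mulr1; lra.
Qed.

(** Let U be the last alpha^k Q of side at most 1 and T the first doubling
    dilate of U.  Then T has side greater than 1 while T' has side at most 1,
    so the mean over T is bounded by condition (c) of rbmo^1, and condition (b)
    compares Q with T.  As U is smaller than [S], K_{Q,U} <= K_{Q,S}. *)
Lemma normr_mean_le_crossing C1 f C Q S : 0 <= C1 -> skips_nondoubling C1 ->
  loc_integrable mu f ->
  bound1 f C -> 0 < side Q -> side Q <= 1 -> 1 < side S ->
  doubling mu alpha beta Q -> 0 < mass mu Q ->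
  `|mean mu Q f| <= C * (K_QR mu n Q S + C1 + beta).
Proof.
move=> C1_ge0 skip f_loc [C_ge0 _ meanC absC] Q0 Q1 S1 DQ mQ.
have [k0 Pk0] := exprn_large (side Q)^-1 alpha_gt1.
case: (ex_minnP (ex_intro (fun k => (side Q)^-1 < alpha ^+ k) _ Pk0)).
move=> {k0 Pk0} [|k].
  by rewrite expr0 invf_lt1// ltNge Q1.
rewrite -(ltr_pM2r Q0) mulVf ?gt_eqF// => kQ mink.
pose U := dilate (alpha ^+ k) Q.
have U0 : 0 < side U by exact: side_dilate_gt0.
have U1 : side U <= 1.
  rewrite leNgt; apply/negP => U1.
  have /mink : (side Q)^-1 < alpha ^+ k.
    by rewrite -(ltr_pM2r Q0) mulVf ?gt_eqF.
  by rewrite ltnn.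
have [m [m0 DT nD]] := exists_doubling_dilate U0.
set T := dilate (alpha ^+ m) U in DT.
have T0 : 0 < side T by exact: side_dilate_gt0.
have QU : cube_set Q `<=` cube_set U.
  rewrite -[X in cube_set X `<=` _](dilate1 Q).
  apply: dilate_sub; first exact: ltW.
  by rewrite exprn_ege1// ltW.
have UT : cube_set U `<=` cube_set T.
  rewrite -[X in cube_set X `<=` _](dilate1 U).
  apply: dilate_sub; first exact: ltW.
  by rewrite exprn_ege1// ltW.
have QT := subset_trans QU UT.
have Tex : scriptQ_ex mu alpha beta T.
  apply: (@dilate_scriptQ_ex U m k) => //.
  by rewrite /U dilate_dilate mulVf ?gt_eqF// dilate1.
have T1 : 1 < side T.
  apply: (lt_le_trans kQ); rewrite /T /= mulrA ler_pM2r// -exprD.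
  by rewrite ler_weXn2l ?(ltW alpha_gt1)// -add1n leq_add2r.
have mT : 0 < mass mu T by apply: lt_le_trans mQ _; exact: le_mass.
have distQT := meanC Q T (conj Q0 Q1) Tex DQ DT QT mQ mT.
have Tbig : (scriptQ_ex mu alpha beta `\` @scriptQ R d) T.
  by split => // -[_]; apply/negP; rewrite -ltNge.
have meanT : `|mean mu T f| <= C * beta.
  apply: (normr_mean_doubling_le f_loc eta_gt1 eta_le_alpha) => //.
  by apply: abs_int_le_of_quot => //; exact: absC.
have KQT := skip Q U m Q0 U0 QU nD.
have KQU := @le_K_QR Q U S Q0 (le_trans U1 (ltW S1)).
rewrite -[mean mu Q f](subrK (mean mu T f)).
apply: (le_trans (ler_normD _ _)); apply: (le_trans (lerD distQT meanT)).
by rewrite -mulrDr ler_wpM2l// lerD2r (le_trans KQT)// lerD2r.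
Qed.

Lemma rbmo_bound_of_rbmo1_bound : exists2 D, 1 <= D &
  forall f C, loc_integrable mu f -> bound1 f C -> bound f (D * C).
Proof.
have [C1 C1_ge0 skip] := K_QR_skip_nondoubling.
pose B : R := (large_overlap eta ^ d)%:R.
have B1 : 1 <= B by rewrite ler1n expn_gt0.
pose D : R := 2 + 2 * C1 + beta + B * beta + B.
have Bb : 0 <= B * beta by rewrite mulr_ge0 ?(ltW beta_gt0).
have b0 := beta_gt0.
exists D; first by rewrite /D; lra.
move=> f C f_loc bf; have [C_ge0 oscC meanC absC] := bf.
have absBig Q : 1 < side Q -> abs_int f Q <= C * B * mass mu (dilate eta Q).
  exact: abs_int_le_big.
have D_le x : x <= D -> x * C <= D * C by exact: ler_wpM2r.
split.
- by rewrite mulr_ge0// /D; lra.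
- move=> Q Q0 Q1 eQ tQ; apply: (le_trans (oscC Q (conj Q0 Q1) eQ tQ)).
  by rewrite -[leLHS]mul1r D_le// /D; lra.
- move=> Q S Q0 S0 Q1 DQ DS QS mQ mS; have K1 := K_QR_ge1 Q S.
  have K0 : 0 <= K_QR mu n Q S by exact: le_trans ler01 K1.
  have [S1|S1] := leP (side S) 1.
    apply: (le_trans (mean_dist_le_small C1_ge0 skip bf Q0 S0 Q1 S1 DQ DS QS mQ mS)).
    by rewrite ler_wpM2r// D_le// /D; lra.
  have mQle := normr_mean_le_crossing C1_ge0 skip f_loc bf Q0 Q1 S1 DQ mQ.
  have mSle : `|mean mu S f| <= C * B * beta.
    apply: (normr_mean_doubling_le f_loc eta_gt1 eta_le_alpha) => //.
      by rewrite mulr_ge0// (le_trans ler01).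
    exact: absBig.
  apply: (le_trans (ler_normB _ _)); apply: (le_trans (lerD mQle mSle)).
  rewrite -[C * B * beta]mulrA -mulrDr [D * C]mulrC -mulrA ler_wpM2l//.
  apply: (@le_trans _ _ ((1 + C1 + beta + B * beta) * K_QR mu n Q S)).
    rewrite !mulrDl mul1r -!addrA lerD2l !addrA.
    by rewrite !lerD// ler_peMr// ltW.
  by rewrite ler_wpM2r// /D; lra.
move=> Q Q0 Q1 eQ; rewrite /abs_quot ler_pdivrMl// mulrC.
apply: (le_trans (absBig Q Q1)); rewrite ler_wpM2r ?mass_ge0// mulrC.
by rewrite D_le// /D; lra.
Qed.

End comparison.

End growth_measure.

Theorem theorem4p1 (R : realType) (d : nat) (hd : (1 <= d)%N)
    (n : R) (hn0 : 0 < n) (hnd : n <= d%:R)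
    (mu : {measure set (borelRd R d) -> \bar R}) (hmu : radon mu)
    (C0 : R) (hC0 : 0 < C0) (hgrowth : growth mu n C0)
    (alpha beta eta : R) (heta : 1 < eta) (heta_alpha : eta <= alpha)
    (hbeta : alpha ^+ d < beta) :
  rbmo1 mu n alpha beta eta = rbmo mu n alpha beta eta /\
  exists C : R, 1 <= C /\
    forall f : borelRd R d -> R, rbmo1 mu n alpha beta eta f ->
      C^-1 * rbmo1_norm mu n alpha beta eta f
        <= rbmo_norm mu n alpha beta eta f /\
      rbmo_norm mu n alpha beta eta f
        <= C * rbmo1_norm mu n alpha beta eta f.
Proof.
have alpha_gt1 : 1 < alpha by exact: lt_le_trans heta_alpha.
have [D D1 le_bound] := rbmo_bound_of_rbmo1_bound hn0 hnd hC0 hgrowth alpha_gt1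
  hbeta heta heta_alpha.
have D0 : 0 < D by exact: lt_le_trans D1.
have ge_bound f C := @rbmo1_bound_of_rbmo_bound _ _ mu n alpha beta eta f C.
split.
  apply/seteqP; split => f [f_loc [C bfC]]; split => //.
    by exists (D * C); exact: le_bound.
  by exists C; exact: ge_bound.
exists D; split => // f [f_loc [C bfC]].
have lb1 : lbound [set C | rbmo1_bound mu n alpha beta eta f C] 0.
  by move=> x [].
have lb : lbound [set C | rbmo_bound mu n alpha beta eta f C] 0.
  by move=> x [].
have norm1_ge0 : 0 <= rbmo1_norm mu n alpha beta eta f.
  by apply: lb_le_inf lb1; exists C.
split.
  apply: (@le_trans _ _ (rbmo1_norm mu n alpha beta eta f)).
    by rewrite ler_piMl// invf_le1.
  apply: lb_le_inf; first by exists (D * C); exact: le_bound.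
  by move=> x /ge_bound bx; apply: ge_inf bx; exists 0.
rewrite -ler_pdivrMl//; apply: lb_le_inf; first by exists C.
move=> x bx; rewrite ler_pdivrMl//; apply: ge_inf; last exact: le_bound.
by exists 0.
Qed.
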